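(* Let $\beta:\mathcal{G}\rightarrow BSet$ be the linear map sending (the class of) a finite simple graph $\Gamma$ to (the class of) its graphical building set $\mathcal{B}(\Gamma)$. Then $\beta$ is an injective morphism of combinatorial Hopf algebras $(\mathcal{G},\zeta_{\mathcal{G}})\rightarrow(BSet,\zeta)$, and $\Psi\circ\beta=\Psi_{\mathcal{G}}$.
   Context: A building set on a finite set $X$ is a collection $\mathcal{B}$ of nonempty subsets of $X$ such that (B1) if $S,S'\in\mathcal{B}$ and $S\cap S'\neq\emptyset$ then $S\cup S'\in\mathcal{B}$, and (B2) $\{i\}\in\mathcal{B}$ for all $i\in X$. Its rank is $|X|$. The restriction to $I\subset X$ is $\mathcal{B}|_I=\{S\in\mathcal{B}: S\subset I\}$; $\mathcal{B}$ is discrete if it consists only of singletons. Two building sets are equivalent if a bijection of ground sets carries one onto the other. $BSet$ is the vector space over a field $\mathbb{K}$ of characteristic $0$ with basis the equivalence classes of building sets, graded by rank, with product $\mathcal{B}_X\cdot\mathcal{B}_Y=\mathcal{B}_X\sqcup\mathcal{B}_Y$ (building set on $X\sqcup Y$) and coproduct $\Delta(\mathcal{B}_X)=\sum_{I\subset X}\mathcal{B}_X|_I\otimes\mathcal{B}_X|_{X\setminus I}$; it is a graded connected commutative cocommutative Hopf algebra. The character $\zeta$ on $BSet$ is $\zeta(\mathcal{B})=1$ if $\mathcal{B}$ is discrete and $0$ otherwise. For a composition $\alpha=(a_1,\dots,a_k)$ of $n=|X|$, $\zeta_\alpha(\mathcal{B}_X)$ is the number of ordered decompositions $X=J_1\sqcup\dots\sqcup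 J_k$ with $|J_i|=a_i$ and $\mathcal{B}_X|_{J_i}$ discrete for all $i$. $\mathcal{G}$ is the Hopf algebra (over $\mathbb{K}$) with basis the isomorphism classes of finite simple graphs, graded by number of vertices, product disjoint union, coproduct $\Delta(\Gamma)=\sum_{I\subset V}\Gamma|_I\otimes\Gamma|_{V\setminus I}$ (induced subgraphs), with character $\zeta_{\mathcal{G}}(\Gamma)=1$ if $\Gamma$ has no edges and $0$ otherwise. For a graph $\Gamma=(V,E)$, the graphical building set is $\mathcal{B}(\Gamma)=\{I\subset V: I\neq\emptyset,\ \Gamma|_I \text{ connected}\}$. A combinatorial Hopf algebra $(\mathcal{H},\zeta)$ is a graded connected Hopf algebra with a multiplicative linear functional $\zeta$; a morphism $(\mathcal{H}_1,\zeta_1)\to(\mathcal{H}_2,\zeta_2)$ is a graded Hopf algebra morphism $\phi$ with $\zeta_2\circ\phi=\zeta_1$. $QSym$ is the Hopf algebra of quasi-symmetric functions with monomial basis $M_\alpha$. $\Psi:BSet\to QSym$ is $\Psi(\mathcal{B})=\sum_{\alpha\models n}\zeta_\alpha(\mathcal{B})M_\alpha$ for $\mathcal{B}$ of rank $n$, and $\Psi_{\mathcal{G}}(\Gamma)=\sum_{\alpha\models n}(\zeta_{\mathcal{G}})_\alpha(\Gamma)M_\alpha$, where $(\zeta_{\mathcal{G}})_\alpha(\Gamma)$ is the number of ordered decompositions $V=J_1\sqcup\dots\sqcup J_k$ with $|J_i|=a_i$ and each $\Gamma|_{J_i}$ edgeless (Stanley's chromatic symmetric function). *)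

(* Defs.v *)
From HB Require Import structures.
From mathcomp Require Import all_boot all_order all_algebra.
From mathcomp Require Import finmap.
From mathcomp.multinomials Require Import monalg.

Set Implicit Arguments.
Unset Strict Implicit.
Unset Printing Implicit Defensive.

Import GRing.Theory.

Local Open Scope quotient_scope.
Local Open Scope ring_scope.

(* [{malg K[T]}] is used only as the K-vector space with basis T; the basis
   vector attached to t is [<< t >>].  The tensor product of the spaces with
   bases S and T is the space with basis S * T. *)

Section LinearExtension.
Context (K : fieldType) (T : choiceType) (V : lmodType K).

Definition linext (f : T -> V) (x : {malg K[T]}) : V :=
  \sum_(t <- msupp x) x@_t *: f t.

Lemma linextEw (f : T -> V) (x : {malg K[T]}) (d : {fset T}) :
  (msupp x `<=` d)%fset -> linext f x = \sum_(t <- d) x@_t *: f t.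
Proof.
move=> sxd; rewrite /linext (big_fset_incl _ sxd) //= => t _ /mcoeff_outdom ->.
by rewrite scale0r.
Qed.

Fact linext_is_linear f : linear (linext f).
Proof.
move=> a x y.
pose d := (msupp (a *: x + y) `|` (msupp x `|` msupp y))%fset.
rewrite (@linextEw _ (a *: x + y) d) ?fsubsetUl //.
rewrite (@linextEw _ x d); last first.
  by apply: fsubset_trans (fsubsetUr _ _); apply: fsubsetUl.
rewrite (@linextEw _ y d); last first.
  by apply: fsubset_trans (fsubsetUr _ _); apply: fsubsetUr.
rewrite scaler_sumr -big_split /=; apply: eq_bigr => t _.
by rewrite mcoeffD mcoeffZ scalerDl scalerA.
Qed.

HB.instance Definition _ f :=
  GRing.isLinear.Build K {malg K[T]} V *:%R (linext f) (linext_is_linear f).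

Lemma linextU f t : linext f << t >> = f t.
Proof. by rewrite /linext msuppU oner_eq0 big_seq_fset1 mcoeffUU scale1r. Qed.

End LinearExtension.

Section Tensor.
Context (K : fieldType).

Definition tens (S T : choiceType) (x : {malg K[S]}) (y : {malg K[T]}) :
    {malg K[(S * T)%type]} :=
  linext (fun s => linext (fun t => << (s, t) >>) y) x.

Definition tensmap (S S' T T' : choiceType)
    (f : {malg K[S]} -> {malg K[S']}) (g : {malg K[T]} -> {malg K[T']}) :
    {malg K[(S * T)%type]} -> {malg K[(S' * T')%type]} :=
  linext (fun p => tens (f << p.1 >>) (g << p.2 >>)).

Definition tensassoc (R S T : choiceType) :
    {malg K[((R * S) * T)%type]} -> {malg K[(R * (S * T))%type]} :=
  linext (fun p => << (p.1.1, (p.1.2, p.2)) >>).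

(* the flip of the two middle factors of (H (x) H) (x) (H (x) H) *)
Definition tensmid (T : choiceType) :
    {malg K[((T * T) * (T * T))%type]} -> {malg K[((T * T) * (T * T))%type]} :=
  linext (fun p => << ((p.1.1, p.2.1), (p.1.2, p.2.2)) >>).

(* e (x) id and id (x) e, followed by K (x) H = H and H (x) K = H *)
Definition tenslunit (T : choiceType) (e : {malg K[T]} -> K) :
    {malg K[(T * T)%type]} -> {malg K[T]} :=
  linext (fun p => e << p.1 >> *: << p.2 >>).

Definition tensrunit (T : choiceType) (e : {malg K[T]} -> K) :
    {malg K[(T * T)%type]} -> {malg K[T]} :=
  linext (fun p => e << p.2 >> *: << p.1 >>).

Definition homog (T : choiceType) (deg : T -> nat) (n : nat)
    (x : {malg K[T]}) : Prop :=
  forall t, t \in msupp x -> deg t = n.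

End Tensor.

(* The underlying graded space is given by a homogeneous basis; multiplication,
   unit, comultiplication, counit and character are arbitrary linear maps, and
   morphisms need not preserve bases. *)
Record chaData (K : fieldType) := ChaData {
  cha_basis : choiceType;
  cha_deg : cha_basis -> nat;
  cha_mul : {linear {malg K[(cha_basis * cha_basis)%type]}
                    -> {malg K[cha_basis]}};
  cha_one : {malg K[cha_basis]};
  cha_delta : {linear {malg K[cha_basis]}
                      -> {malg K[(cha_basis * cha_basis)%type]}};
  cha_eps : {linear {malg K[cha_basis]} -> K^o};
  cha_zeta : {linear {malg K[cha_basis]} -> K^o}
}.

Definition cha_space (K : fieldType) (H : chaData K) := {malg K[cha_basis H]}.

Definition cha_homog (K : fieldType) (H : chaData K) (n : nat)
    (x : cha_space H) : Prop :=
  homog (@cha_deg K H) n x.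

Definition cha_homog2 (K : fieldType) (H : chaData K) (n : nat)
    (x : {malg K[(cha_basis H * cha_basis H)%type]}) : Prop :=
  homog (fun p => cha_deg p.1 + cha_deg p.2)%N n x.

Section HopfConditions.
Context (K : fieldType) (H : chaData K).

Local Notation mu := (@cha_mul K H).
Local Notation one := (cha_one H).
Local Notation Delta := (@cha_delta K H).
Local Notation eps := (@cha_eps K H).
Local Notation zeta := (@cha_zeta K H).

Record is_bialgebra : Prop := IsBialgebra {
  mul_assoc : forall x, mu (tensmap mu id x) = mu (tensmap id mu (tensassoc x));
  mul_onel : forall x, mu (tens one x) = x;
  mul_oner : forall x, mu (tens x one) = x;
  delta_coassoc : forall x,
    tensassoc (tensmap Delta id (Delta x)) = tensmap id Delta (Delta x);
  delta_epsl : forall x, tenslunit eps (Delta x) = x;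
  delta_epsr : forall x, tensrunit eps (Delta x) = x;
  delta_mul : forall x,
    Delta (mu x) = tensmap mu mu (tensmid (tensmap Delta Delta x));
  delta_one : Delta one = tens one one;
  eps_mul : forall x y, eps (mu (tens x y)) = eps x * eps y;
  eps_one : eps one = 1
}.

Definition is_antipode (S : {linear cha_space H -> cha_space H}) : Prop :=
  forall x, mu (tensmap S id (Delta x)) = eps x *: one
         /\ mu (tensmap id S (Delta x)) = eps x *: one.

Record is_graded_connected : Prop := IsGradedConnected {
  mul_homog : forall n x, cha_homog2 n x -> cha_homog n (mu x);
  one_homog : cha_homog 0 one;
  delta_homog : forall n x, cha_homog n x -> cha_homog2 n (Delta x);
  eps_homog : forall n x, cha_homog n.+1 x -> eps x = 0;
  connected0 : forall x, cha_homog 0 x -> exists c : K, x = c *: one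
}.

Record is_cha : Prop := IsCha {
  cha_bialgebra : is_bialgebra;
  cha_antipode : exists S, is_antipode S;
  cha_graded_connected : is_graded_connected;
  zeta_mul : forall x y, zeta (mu (tens x y)) = zeta x * zeta y;
  zeta_one : zeta one = 1
}.

End HopfConditions.

Record is_cha_morphism (K : fieldType) (H1 H2 : chaData K)
    (f : {linear cha_space H1 -> cha_space H2}) : Prop := IsChaMorphism {
  chaM_source : is_cha H1;
  chaM_target : is_cha H2;
  chaM_mul : forall x, f (cha_mul H1 x) = cha_mul H2 (tensmap f f x);
  chaM_one : f (cha_one H1) = cha_one H2;
  chaM_delta : forall x, cha_delta H2 (f x) = tensmap f f (cha_delta H1 x);
  chaM_eps : forall x, cha_eps H2 (f x) = cha_eps H1 x;
  chaM_homog : forall n x, cha_homog n x -> cha_homog n (f x);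
  chaM_zeta : forall x, cha_zeta H2 (f x) = cha_zeta H1 x
}.

Section Families.
Implicit Types X Y : finType.

Definition relabel X Y (f : X -> Y) (F : {set {set X}}) : {set {set Y}} :=
  [set f @: S | S : {set X} in F].

(* the members of F contained in I, as subsets of the finite type I *)
Definition restr X (F : {set {set X}}) (I : {set X}) :
    {set {set {x : X | x \in I}}} :=
  [set S : {set {x : X | x \in I}} | val @: S \in F].

Definition dunion X Y (F : {set {set X}}) (G : {set {set Y}}) :
    {set {set X + Y}} :=
  relabel inl F :|: relabel inr G.

Definition fam_iso X Y (F : {set {set X}}) (G : {set {set Y}}) : Prop :=
  exists2 f : X -> Y, bijective f & relabel f F = G.

Lemma imset_can X Y (f : X -> Y) g (S : {set X}) :
  cancel f g -> g @: (f @: S) = S.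
Proof.
by move=> fK; rewrite -imset_comp (eq_imset _ (g := id)) ?imset_id.
Qed.

Lemma mem_relabel X Y (f : X -> Y) g F S :
  cancel f g -> cancel g f -> (S \in relabel f F) = (g @: S \in F).
Proof.
move=> fK gK; apply/imsetP/idP => [[S' S'F ->]|SF]; first by rewrite imset_can.
by exists (g @: S); rewrite // imset_can.
Qed.

Lemma relabel_comp X Y (Z : finType) (f : X -> Y) (g : Y -> Z) F :
  relabel g (relabel f F) = relabel (g \o f) F.
Proof.
by rewrite /relabel -imset_comp; apply: eq_imset => S /=; rewrite imset_comp.
Qed.

Lemma relabel_id X (F : {set {set X}}) f : f =1 id -> relabel f F = F.
Proof.
move=> fE; rewrite /relabel (eq_imset _ (g := id)) ?imset_id // => S.
by rewrite (eq_imset _ fE) imset_id.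
Qed.

Lemma fam_iso_refl X (F : {set {set X}}) : fam_iso F F.
Proof. by exists id; [exists id | apply: relabel_id]. Qed.

Lemma fam_iso_sym X Y (F : {set {set X}}) (G : {set {set Y}}) :
  fam_iso F G -> fam_iso G F.
Proof.
case=> f [g fK gK] <-; exists g; first by exists f.
by rewrite relabel_comp relabel_id.
Qed.

Lemma fam_iso_trans X Y (Z : finType) (F : {set {set X}}) (G : {set {set Y}})
    (H : {set {set Z}}) : fam_iso F G -> fam_iso G H -> fam_iso F H.
Proof.
case=> f bf <- [g bg <-]; exists (g \o f); first exact: bij_comp.
by rewrite relabel_comp.
Qed.

Lemma fam_iso_restr X Y (f : X -> Y) F I : bijective f ->
  fam_iso (restr F I) (restr (relabel f F) (f @: I)).
Proof.
case=> g fK gK.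
have gI (y : Y) : y \in f @: I -> g y \in I.
  by case/imsetP=> x xI ->; rewrite fK.
pose h (u : {x | x \in I}) : {y | y \in f @: I} :=
  exist _ (f (val u)) (imset_f f (valP u)).
pose k (u : {y | y \in f @: I}) : {x | x \in I} :=
  exist _ (g (val u)) (gI _ (valP u)).
have hK : cancel h k by move=> u; apply: val_inj; rewrite /= fK.
have kK : cancel k h by move=> u; apply: val_inj; rewrite /= gK.
exists h; first by exists k.
apply/setP=> S; rewrite (mem_relabel _ _ hK kK) !inE (mem_relabel _ _ fK gK).
by congr (_ \in F); rewrite -!imset_comp; apply: eq_imset => u.
Qed.

Lemma fam_iso_dunion X X' Y Y' (F : {set {set X}}) (F' : {set {set X'}})
    (G : {set {set Y}}) (G' : {set {set Y'}}) :
  fam_iso F F' -> fam_iso G G' -> fam_iso (dunion F G) (dunion F' G').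
Proof.
case=> f [f' fK f'K] <- [g [g' gK g'K] <-].
pose h (u : X + Y) : X' + Y' :=
  match u with inl x => inl (f x) | inr y => inr (g y) end.
exists h.
  exists (fun u => match u with inl x => inl (f' x) | inr y => inr (g' y) end).
    by case=> x /=; rewrite ?fK ?gK.
  by case=> x /=; rewrite ?f'K ?g'K.
by rewrite /dunion {1}/relabel imsetU -/(relabel _ _) -/(relabel _ _)
           !relabel_comp.
Qed.

End Families.

(* Finite simple graphs (as sets of edges) and building sets are both families
   of subsets, restricted, added and relabelled by the same formulas; [sc_null]
   tells on which objects the character takes the value 1. *)
Record setClass := SetClass {
  sc_mem : forall X : finType, {set {set X}} -> bool;
  sc_null : forall X : finType, {set {set X}} -> bool;
  sc_mem0 : sc_mem (set0 : {set {set 'I_0}});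
  sc_mem_relabel : forall (X Y : finType) (f : X -> Y) (F : {set {set X}}),
    bijective f -> sc_mem F -> sc_mem (relabel f F);
  sc_mem_restr : forall (X : finType) (F : {set {set X}}) (I : {set X}),
    sc_mem F -> sc_mem (restr F I);
  sc_mem_dunion : forall (X Y : finType) (F : {set {set X}}) (G : {set {set Y}}),
    sc_mem F -> sc_mem G -> sc_mem (dunion F G);
  sc_null_relabel : forall (X Y : finType) (f : X -> Y) (F : {set {set X}}),
    bijective f -> sc_null F -> sc_null (relabel f F)
}.

Definition member (C : setClass) (X : finType) :=
  {F : {set {set X}} | sc_mem C F}.

Section Classes.
Context (C : setClass).

Definition restr_member (X : finType) (F : member C X) (I : {set X}) :
    member C {x : X | x \in I} :=
  exist _ (restr (val F) I) (sc_mem_restr I (valP F)).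

Definition dunion_member (X Y : finType) (F : member C X) (G : member C Y) :
    member C (X + Y)%type :=
  exist _ (dunion (val F) (val G)) (sc_mem_dunion (valP F) (valP G)).

Definition empty_member : member C 'I_0 := exist _ set0 (sc_mem0 C).

Definition std_member : Type := {n : nat & member C 'I_n}.
HB.instance Definition _ := Choice.copy std_member {n : nat & member C 'I_n}.

Definition std_fam (u : std_member) : {set {set 'I_(tag u)}} :=
  val (tagged u : member C 'I_(tag u)).

(* On finite types of equal cardinality, bijective = injective. *)
Definition std_iso (u v : std_member) : bool :=
  (tag u == tag v) &&
  [exists f : {ffun 'I_(tag u) -> 'I_(tag v)},
     injectiveb f && (relabel f (std_fam u) == std_fam v)].

Lemma std_isoP u v :
  reflect (fam_iso (std_fam u) (std_fam v)) (std_iso u v).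
Proof.
apply: (iffP andP) => [[/eqP e /existsP[f /andP[/injectiveP fi /eqP fE]]]|].
  exists f => //; apply: inj_card_bij => //.
  by rewrite !card_ord e.
case=> f bf fE; split.
  by have := bij_eq_card bf; rewrite !card_ord => ->.
apply/existsP; exists (finfun f); apply/andP; split.
  by apply/injectiveP => x y; rewrite !ffunE; apply: (bij_inj bf).
apply/eqP; rewrite -fE; apply: eq_imset => S.
by apply: eq_imset => x; rewrite ffunE.
Qed.

Fact std_iso_equiv : equiv_class_of std_iso.
Proof.
split=> [u|u v|v u w].
- by apply/std_isoP; apply: fam_iso_refl.
- by apply/std_isoP/std_isoP => /fam_iso_sym.
- by move=> /std_isoP uv /std_isoP vw; apply/std_isoP; apply: fam_iso_trans vw.
Qed.

Canonical std_iso_equivRel := EquivRelPack std_iso_equiv.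

Definition iso_class : choiceType := {eq_quot std_iso}.

Definition std_of (X : finType) (F : member C X) : std_member :=
  Tagged (fun n => member C 'I_n)
    (exist _ (relabel enum_rank (val F))
       (sc_mem_relabel (enum_rank_bij X) (valP F)) : member C 'I_#|X|).

Definition class_of (X : finType) (F : member C X) : iso_class :=
  \pi_iso_class (std_of F).

(* Operations on classes are computed on the chosen representative; class_mulE,
   class_nullE, member_delta_class, Psi_class and beta_class show that any object
   on any finite type gives the same result. *)
Definition class_rank (a : iso_class) : nat := tag (repr a).
Definition class_repr (a : iso_class) : member C 'I_(class_rank a) :=
  tagged (repr a).

Lemma class_eqP (X Y : finType) (F : member C X) (G : member C Y) :
  class_of F = class_of G <-> fam_iso (val F) (val G).
Proof.
have iF (Z : finType) (L : member C Z) :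
    fam_iso (val L) (std_fam (std_of L)).
  by exists enum_rank; first exact: enum_rank_bij.
split=> [/eqmodP/std_isoP|] h.
  by apply: fam_iso_trans (fam_iso_sym (iF _ G)); apply: fam_iso_trans h.
apply/eqmodP/std_isoP; apply: fam_iso_trans (iF _ G).
exact: fam_iso_trans (fam_iso_sym (iF _ F)) h.
Qed.

Lemma class_reprK a : class_of (class_repr a) = a.
Proof.
rewrite -[RHS]reprK; apply/eqmodP/std_isoP/fam_iso_sym.
by exists enum_rank; first exact: enum_rank_bij.
Qed.

Lemma class_repr_iso (X : finType) (F : member C X) :
  fam_iso (val (class_repr (class_of F))) (val F).
Proof. by apply/class_eqP; rewrite class_reprK. Qed.

Lemma class_rankE (X : finType) (F : member C X) : class_rank (class_of F) = #|X|.
Proof. by case: (class_repr_iso F) => f /bij_eq_card; rewrite card_ord. Qed.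

Definition class_mul (a b : iso_class) : iso_class :=
  class_of (dunion_member (class_repr a) (class_repr b)).

Lemma class_mulE (X Y : finType) (F : member C X) (G : member C Y) :
  class_mul (class_of F) (class_of G) = class_of (dunion_member F G).
Proof.
apply/class_eqP; apply: fam_iso_dunion; exact: class_repr_iso.
Qed.

Definition class_null (a : iso_class) : bool := sc_null C (val (class_repr a)).

Lemma sc_null_iso (X Y : finType) (F : {set {set X}}) (G : {set {set Y}}) :
  fam_iso F G -> sc_null C F = sc_null C G.
Proof.
have h (Z T : finType) (L : {set {set Z}}) (M : {set {set T}}) :
    fam_iso L M -> sc_null C L -> sc_null C M.
  by case=> f bf <-; apply: sc_null_relabel.
by move=> FG; apply/idP/idP; apply: h => //; apply: fam_iso_sym.
Qed.

Lemma class_nullE (X : finType) (F : member C X) :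
  class_null (class_of F) = sc_null C (val F).
Proof. exact: sc_null_iso (class_repr_iso F). Qed.

Section Hopf.
Context (K : fieldType).

Definition member_delta (X : finType) (F : member C X) :
    {malg K[(iso_class * iso_class)%type]} :=
  \sum_(I : {set X})
    << (class_of (restr_member F I), class_of (restr_member F (~: I))) >>.

Lemma member_delta_class (X : finType) (F : member C X) :
  member_delta (class_repr (class_of F)) = member_delta F.
Proof.
case: (class_repr_iso F) => f bf fE; rewrite /member_delta.
have fb : bijective (fun I : {set 'I_(class_rank (class_of F))} => f @: I).
  by case: bf => g fK gK; exists (fun J : {set X} => g @: J) => I;
    apply: imset_can.
rewrite [RHS](reindex _ (onW_bij _ fb)) /=; apply: eq_bigr => I _.
have -> : ~: (f @: I) = f @: ~: I.
  case: bf => g fK gK; apply/setP=> x; rewrite inE.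
  by rewrite -[x]gK !(mem_imset _ _ (can_inj fK)) inE.
congr << (_, _) >>; apply/class_eqP; rewrite /= -fE; exact: fam_iso_restr.
Qed.

Definition class_hopf : chaData K := {|
  cha_basis := iso_class;
  cha_deg := class_rank;
  cha_mul := linext (fun p : iso_class * iso_class => << class_mul p.1 p.2 >>);
  cha_one := << class_of empty_member >>;
  cha_delta := linext (fun a => member_delta (class_repr a));
  cha_eps := linext (fun a => (class_rank a == 0%N)%:R : K^o);
  cha_zeta := linext (fun a => (class_null a)%:R : K^o)
|}.

End Hopf.

End Classes.

Definition composition := {s : seq nat | 0%N \notin s}.

(* A composition of n has at most n parts, all at most n. *)
Definition compositions (n : nat) : seq composition :=
  undup (pmap insub
    [seq s <- [seq map val (val t) | k <- iota 0 n.+1,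
                                     t <- enum {: k.-tuple 'I_n.+1}]
       | sumn s == n]).

Lemma mem_compositions n (a : composition) :
  (a \in compositions n) = (sumn (val a) == n).
Proof.
rewrite mem_undup mem_pmap_sub mem_filter andb_idr // => /eqP an.
have le_an x : x \in val a -> (x < n.+1)%N.
  by move=> xa; rewrite ltnS -an sumnE (big_rem x) //= leq_addr.
have le_sz : (size (val a) < n.+1)%N.
  rewrite ltnS -an sumnE -sum1_size !big_seq; apply: leq_sum => x xa.
  by rewrite lt0n; apply/negP => /eqP x0; have /negP := valP a; rewrite -{1}x0.
apply/allpairsPdep; exists (size (val a)).
have sz : size (map (@inord n) (val a)) == size (val a) by rewrite size_map.
exists (Tuple sz).
split; rewrite ?mem_iota ?mem_enum //= -map_comp -[LHS]map_id.
by apply/eq_in_map => x /le_an xn /=; rewrite inordK.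
Qed.

(* QSym, through its monomial basis *)
Definition QSym (K : fieldType) := {malg K[composition]}.
Definition QSym_M (K : fieldType) (a : composition) : QSym K := << a >>.

Section Psi.
Context (C : setClass).

(* zeta_alpha(F) is the number of these ordered decompositions, alpha = a. *)
Definition decompositions (X : finType) (F : {set {set X}}) (a : seq nat) :
    {set {ffun 'I_(size a) -> {set X}}} :=
  [set J : {ffun 'I_(size a) -> {set X}} |
    [&& [forall i, #|J i| == nth 0%N a i],
        [forall i, forall j, (i != j) ==> [disjoint J i & J j]],
        \bigcup_i J i == [set: X]
      & [forall i, sc_null C (restr F (J i))]]].

Context (K : fieldType).

Definition member_Psi (X : finType) (F : member C X) : QSym K :=
  \sum_(a <- compositions #|X|)
    #|decompositions (val F) (val a)|%:R *: QSym_M K a.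

Definition Psi : {linear cha_space (class_hopf C K) -> QSym K} :=
  linext (fun a => member_Psi (class_repr a)).

Lemma card_decompositions_iso (X Y : finType) (F : {set {set X}})
    (G : {set {set Y}}) (a : seq nat) :
  fam_iso F G -> #|decompositions F a| = #|decompositions G a|.
Proof.
suff le (Z T : finType) (L : {set {set Z}}) (M : {set {set T}}) :
    fam_iso L M -> (#|decompositions L a| <= #|decompositions M a|)%N.
  by move=> FG; apply/eqP; rewrite eqn_leq !le //; apply: fam_iso_sym.
case=> f bf <-; have fi := bij_inj bf; have [g fK gK] := bf.
pose h (J : {ffun 'I_(size a) -> {set Z}}) : {ffun 'I_(size a) -> {set T}} :=
  [ffun i => f @: J i].
have hi : injective h.
  move=> J J' /ffunP e; apply/ffunP=> i; have := e i; rewrite !ffunE.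
  exact: imset_inj.
rewrite -(card_imset _ hi) subset_leq_card //; apply/subsetP => _ /imsetP[J + ->].
rewrite !inE => /and4P[/forallP J1 /forallP J2 /eqP J3 /forallP J4].
apply/and4P; split.
- by apply/forallP=> i; rewrite ffunE card_imset.
- apply/forallP=> i; apply/forallP=> j; rewrite !ffunE; apply/implyP=> ij.
  by rewrite imset_disjoint //; move/forallP: (J2 i) => /(_ j) /implyP; apply.
- apply/eqP/setP=> y; rewrite inE -[y]gK.
  have : g y \in \bigcup_i J i by rewrite J3 inE.
  by case/bigcupP=> i _ gi; apply/bigcupP; exists i; rewrite // ffunE imset_f.
apply/forallP=> i; rewrite ffunE -(sc_null_iso _ (fam_iso_restr _ _ bf)).
exact: J4.
Qed.

Lemma member_Psi_class (X : finType) (F : member C X) :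
  member_Psi (class_repr (class_of F)) = member_Psi F.
Proof.
have iF := class_repr_iso F; rewrite /member_Psi.
have -> : #|'I_(class_rank (class_of F))| = #|X|.
  by case: iF => f /bij_eq_card.
by apply: eq_bigr => a _; rewrite (card_decompositions_iso _ iF).
Qed.

Lemma Psi_class (X : finType) (F : member C X) :
  Psi << class_of F >> = member_Psi F.
Proof. by rewrite /Psi /= linextU member_Psi_class. Qed.
End Psi.

Section GraphsAndBuildingSets.
Implicit Types X Y : finType.

(* A finite simple graph on X is given by its set of edges. *)
Definition is_graph X (E : {set {set X}}) : bool := [forall e in E, #|e| == 2%N].

Definition edgeless X (E : {set {set X}}) : bool := E == set0.

Definition adj X (E : {set {set X}}) : rel X := [rel x y | [set x; y] \in E].

Definition connected X (E : {set {set X}}) : bool :=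
  [forall x, forall y, connect (adj E) x y].

Definition is_building X (B : {set {set X}}) : bool :=
  [&& set0 \notin B,
      [forall S in B, forall S' in B, (S :&: S' != set0) ==> (S :|: S' \in B)]
    & [forall i, [set i] \in B]].

Definition discrete X (B : {set {set X}}) : bool := [forall S in B, #|S| == 1%N].

Definition graphical X (E : {set {set X}}) : {set {set X}} :=
  [set I : {set X} | (I != set0) && connected (restr E I)].

Lemma is_buildingP X (B : {set {set X}}) :
  reflect [/\ set0 \notin B,
              forall S S', S \in B -> S' \in B -> S :&: S' != set0 ->
                S :|: S' \in B
            & forall i, [set i] \in B]
          (is_building B).
Proof.
apply: (iffP and3P) => -[B0 BU B1]; split=> //; last exact/forallP.
- move=> S S' SB S'B; move/forall_inP: BU => /(_ S SB) /forall_inP /(_ S' S'B).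
  exact/implyP.
- by move=> i; move/forallP: B1.
by apply/forall_inP=> S SB; apply/forall_inP=> S' S'B; apply/implyP; apply: BU.
Qed.

Fact is_graph0 : is_graph (set0 : {set {set 'I_0}}).
Proof. by apply/forall_inP=> e; rewrite inE. Qed.

Fact is_graph_relabel X Y (f : X -> Y) E :
  bijective f -> is_graph E -> is_graph (relabel f E).
Proof.
move=> /bij_inj fi /forall_inP gE; apply/forall_inP=> _ /imsetP[e eE ->].
by rewrite card_imset // gE.
Qed.

Fact is_graph_restr X (E : {set {set X}}) I : is_graph E -> is_graph (restr E I).
Proof.
move=> /forall_inP gE; apply/forall_inP=> e; rewrite inE => /gE.
by rewrite card_imset //; apply: val_inj.
Qed.

Fact is_graph_dunion X Y (E : {set {set X}}) (E' : {set {set Y}}) :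
  is_graph E -> is_graph E' -> is_graph (dunion E E').
Proof.
move=> /forall_inP gE /forall_inP gE'; apply/forall_inP=> e.
by rewrite inE => /orP[] /imsetP[e' e'E ->]; rewrite card_imset ?gE ?gE' //;
   move=> x y [].
Qed.

Fact edgeless_relabel X Y (f : X -> Y) E :
  bijective f -> edgeless E -> edgeless (relabel f E).
Proof. by move=> _ /eqP->; rewrite /edgeless /relabel imset0. Qed.

Fact is_building0 : is_building (set0 : {set {set 'I_0}}).
Proof. by apply/is_buildingP; split=> [|S S'|[]//]; rewrite !inE. Qed.

Fact is_building_relabel X Y (f : X -> Y) B :
  bijective f -> is_building B -> is_building (relabel f B).
Proof.
case=> g fK gK /is_buildingP[B0 BU B1].
have mB S : (S \in relabel f B) = (g @: S \in B) by rewrite (mem_relabel _ _ fK gK).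
apply/is_buildingP; split; first by rewrite mB imset0.
  move=> S S'; rewrite !mB imsetU => SB S'B SS'; apply: BU => //.
  rewrite -imsetI; last by move=> x y _ _; apply: (can_inj gK).
  by case/set0Pn: SS' => y yS; apply/set0Pn; exists (g y); rewrite imset_f.
by move=> i; rewrite mB imset_set1.
Qed.

Fact is_building_restr X (B : {set {set X}}) I :
  is_building B -> is_building (restr B I).
Proof.
case/is_buildingP=> [B0 BU B1]; apply/is_buildingP; split.
- by rewrite inE imset0.
- move=> S S'; rewrite !inE imsetU => SB S'B SS'; apply: BU => //.
  rewrite -imsetI; last by move=> x y _ _; apply: val_inj.
  by case/set0Pn: SS' => y yS; apply/set0Pn; exists (val y); rewrite imset_f.
by move=> i; rewrite inE imset_set1.
Qed.

Fact is_building_dunion X Y (B : {set {set X}}) (B' : {set {set Y}}) :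
  is_building B -> is_building B' -> is_building (dunion B B').
Proof.
case/is_buildingP=> [B0 BU B1] /is_buildingP[B'0 B'U B'1].
have inlI : injective (@inl X Y) by move=> x y [].
have inrI : injective (@inr X Y) by move=> x y [].
have im0 (Z T : finType) (h : Z -> T) (F : {set {set Z}}) :
    set0 \notin F -> set0 \notin relabel h F.
  apply: contra => /imsetP[S SF /esym/eqP]; rewrite imset_eq0 => /eqP S0.
  by rewrite -S0.
apply/is_buildingP; split; first by rewrite inE negb_or !im0.
  move=> _ _ /setUP[] /imsetP[S SB ->] /setUP[] /imsetP[S' S'B ->].
  - rewrite -imsetI => [SS'|]; last by move=> x y _ _; apply: inlI.
    rewrite -imsetU inE imset_f // BU //.
    by apply: contra_neq SS' => ->; rewrite imset0.
  - by case/set0Pn=> u /setIP[/imsetP[x _ ->] /imsetP[]].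
  - by case/set0Pn=> u /setIP[/imsetP[x _ ->] /imsetP[]].
  rewrite -imsetI => [SS'|]; last by move=> x y _ _; apply: inrI.
  rewrite -imsetU inE orbC imset_f // B'U //.
  by apply: contra_neq SS' => ->; rewrite imset0.
by case=> i; rewrite inE -imset_set1 imset_f ?orbT.
Qed.

Fact discrete_relabel X Y (f : X -> Y) B :
  bijective f -> discrete B -> discrete (relabel f B).
Proof.
move=> /bij_inj fi /forall_inP dB; apply/forall_inP=> _ /imsetP[S SB ->].
by rewrite card_imset // dB.
Qed.

Lemma connect_homo X Y (e : rel X) (e' : rel Y) (h : X -> Y) :
  {homo h : x y / e x y >-> e' x y} ->
  {homo h : x y / connect e x y >-> connect e' x y}.
Proof.
move=> he x _ /connectP[p + ->]; elim: p x => [|y p IHp] x /=.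
  by rewrite connect0.
by case/andP=> /he/connect1 xy /IHp; apply: connect_trans.
Qed.

Lemma connected_iso X Y (E : {set {set X}}) (E' : {set {set Y}}) :
  fam_iso E E' -> connected E -> connected E'.
Proof.
case=> f [g fK gK] <- /forallP cE.
apply/forallP=> x; apply/forallP=> y; rewrite -[x]gK -[y]gK.
apply: (connect_homo (e := adj E)); last by move/forallP: (cE (g x)).
move=> u v; rewrite /adj /= => uv.
by apply/imsetP; exists [set u; v]; rewrite // imsetU1 imset_set1.
Qed.

Lemma graphical_relabel X Y (f : X -> Y) E :
  bijective f -> relabel f (graphical E) = graphical (relabel f E).
Proof.
move=> bf; have [g fK gK] := bf; apply/setP=> S.
rewrite (mem_relabel _ _ fK gK) !inE imset_eq0; congr (_ && _).
have iS : fam_iso (restr E (g @: S)) (restr (relabel f E) S).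
  by have := fam_iso_restr E (g @: S) bf; rewrite (imset_can _ gK).
by apply/idP/idP; apply: connected_iso => //; apply: fam_iso_sym.
Qed.

Lemma is_building_graphical X (E : {set {set X}}) : is_building (graphical E).
Proof.
apply/is_buildingP; split.
- by rewrite inE eqxx.
- move=> S S'; rewrite !inE => /andP[S0 cS] /andP[_ cS'] SS'.
  rewrite setU_eq0 negb_and S0 /=.
  have inc (I J : {set X}) (sIJ : I \subset J) (cI : connected (restr E I))
      (x y : X) (xI : x \in I) (yI : y \in I) (xJ : x \in J) (yJ : y \in J) :
      connect (adj (restr E J)) (exist _ x xJ) (exist _ y yJ).
    pose h (u : {x | x \in I}) : {x | x \in J} :=
      exist _ (val u) (subsetP sIJ _ (valP u)).
    have -> : exist _ x xJ = h (exist _ x xI) by apply: val_inj.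
    have -> : exist _ y yJ = h (exist _ y yI) by apply: val_inj.
    apply: (connect_homo (e := adj (restr E I))); last first.
      by move/forallP: cI => /(_ (exist _ x xI)) /forallP.
    by move=> u v; rewrite /adj /= !inE !imsetU1 !imset_set1.
  case/set0Pn: SS' => z /setIP[zS zS'].
  have zU : z \in S :|: S' by rewrite inE zS.
  have [sS sS'] := (subsetUl S S', subsetUr S S').
  apply/forallP=> -[x xU]; apply/forallP=> -[y yU].
  apply: (connect_trans (y := exist _ z zU)).
    by case/setUP: {-}(xU) => ?; [apply: (inc S) | apply: (inc S')].
  by case/setUP: {-}(yU) => ?; [apply: (inc S) | apply: (inc S')].
move=> i; rewrite inE; apply/andP; split; first by apply/set0Pn; exists i; rewrite inE.
apply/forallP=> -[x xi]; apply/forallP=> -[y yi].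
suff -> : exist _ x xi = exist (fun x => x \in [set i]) y yi by apply: connect0.
by apply: val_inj => /=; move: xi yi; rewrite !inE => /eqP-> /eqP->.
Qed.

End GraphsAndBuildingSets.

Definition graphs : setClass :=
  SetClass is_graph0 is_graph_relabel is_graph_restr is_graph_dunion
           edgeless_relabel.

Definition building_sets : setClass :=
  SetClass is_building0 is_building_relabel is_building_restr
           is_building_dunion discrete_relabel.

Definition graph (X : finType) := member graphs X.
Definition building_set (X : finType) := member building_sets X.

Definition graphical_building (X : finType) (E : graph X) : building_set X :=
  exist _ (graphical (val E)) (is_building_graphical (val E)).

Section Beta.
Context (K : fieldType).

Definition GraphHopf : chaData K := class_hopf graphs K.
Definition BSet : chaData K := class_hopf building_sets K.

Definition beta : {linear cha_space GraphHopf -> cha_space BSet} :=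
  linext (fun a : iso_class graphs =>
    << class_of (graphical_building (class_repr a)) >>).

Lemma beta_class (X : finType) (E : graph X) :
  beta << class_of E >> = << class_of (graphical_building E) >>.
Proof.
rewrite /beta /= linextU; congr << _ >>; apply/class_eqP.
case: (class_repr_iso E) => f bf fE; exists f => //.
by rewrite /= -fE graphical_relabel.
Qed.

Definition Psi_BSet : {linear cha_space BSet -> QSym K} := Psi building_sets K.
Definition Psi_Graph : {linear cha_space GraphHopf -> QSym K} := Psi graphs K.

End Beta.

(* Main.v *)
Require Import Defs.
From HB Require Import structures.
From mathcomp Require Import all_boot all_order all_algebra.
From mathcomp Require Import finmap.
From mathcomp.multinomials Require Import monalg.

(** Both families of objects are families of subsets, and restriction, disjoint
    union and relabelling are given by the same formulas, so the Hopf algebra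
    axioms are checked once: on basis elements each one is a bijection between
    sets of (pairs of) subsets.  The antipode solves [S * id = 1 eps] by
    recursion on the rank; commutativity and cocommutativity make it two-sided.
    The map beta respects the operations because connectedness of a set of
    vertices depends only on the edges inside it and no connected set meets both
    parts of a disjoint union.  It is injective because it maps the basis
    injectively into a basis: the edges of a graph are the two-element members
    of its graphical building set.  For the same reason a graph is edgeless
    exactly when its building set is discrete, which gives the equality of
    characters and, through restrictions, of the coefficients of Psi. *)

Set Implicit Arguments.
Unset Strict Implicit.
Unset Printing Implicit Defensive.

Import GRing.Theory.
Local Open Scope ring_scope.

(** * The space with a given basis *)

(* [<< t >>] is elaborated through several convertible but syntactically
   different paths from [fieldType]; a locked name keeps unification cheap. *)
HB.lock Definition vec (K : fieldType) (T : choiceType) (t : T) :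
  {malg K[T]} := << t >>.

Section MalgLinear.
Context (K : fieldType).

Lemma malg_lin_ind (T : choiceType) (P : {malg K[T]} -> Prop) :
  (forall t, P (vec K t)) -> P 0 ->
  (forall c x y, P x -> P y -> P (c *: x + y)) -> forall x, P x.
Proof.
move=> PU P0 PD x; rewrite [x]monalgE; elim/big_ind: _ => //.
  by move=> y z Py Pz; rewrite -[y]scale1r; apply: PD.
move=> t _; rewrite -[X in P X]addr0.
have -> : << x@_t *g t >> = x@_t *: vec K t.
  by apply/malgP=> u; rewrite vec.unlock mcoeffZ !mcoeffU mulr_natr.
exact: PD.
Qed.

Lemma linext_vec (T : choiceType) (V : lmodType K) (f : T -> V) t :
  linext f (vec K t) = f t.
Proof. by rewrite vec.unlock linextU. Qed.

(** Reduces each identity between linear maps to basis vectors; the two sides are passed explicitly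
    as composites of linear maps. *)
Lemma malg_lin_ext (T : choiceType) (V : lmodType K)
    (f g : {linear {malg K[T]} -> V}) :
  (forall t, f (vec K t) = g (vec K t)) -> f =1 g.
Proof.
move=> fg; elim/malg_lin_ind => [//||c x y fx fy]; first by rewrite !linear0.
by rewrite !linearP fx fy.
Qed.

(** * Bilinearity of the tensor product *)

Section TensLinear.
Context (S T : choiceType).

Lemma tens_linear_l (y : {malg K[T]}) :
  linear (fun x : {malg K[S]} => tens x y).
Proof. by move=> c x x'; rewrite /tens linearP. Qed.

Lemma tens_linear_r (x : {malg K[S]}) : linear (@tens K S T x).
Proof.
move=> c y y'; rewrite /tens /linext scaler_sumr -big_split /=.
apply: eq_bigr => s _.
by rewrite -!/(linext _ _) linearP scalerDr !scalerA mulrC.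
Qed.

HB.instance Definition _ x :=
  GRing.isLinear.Build K {malg K[T]} {malg K[(S * T)%type]} *:%R
    (@tens K S T x) (tens_linear_r x).

(** A named function with swapped arguments, so that linearity of [tens] in its first argument can
    be registered as an instance. *)
Definition rtens (y : {malg K[T]}) (x : {malg K[S]}) := tens x y.
HB.instance Definition _ y :=
  GRing.isLinear.Build K {malg K[S]} {malg K[(S * T)%type]} *:%R
    (rtens y) (tens_linear_l y).

Lemma tens_suml I (r : seq I) (P : pred I) (F : I -> {malg K[S]})
    (y : {malg K[T]}) :
  tens (\sum_(i <- r | P i) F i) y = \sum_(i <- r | P i) tens (F i) y.
Proof. exact: (linear_sum (rtens y)). Qed.

Lemma tensU (s : S) (t : T) : tens (vec K s) (vec K t) = vec K (s, t).
Proof. by rewrite /tens !linext_vec vec.unlock. Qed.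

End TensLinear.

Section Tensmap.
Context (S S' T T' : choiceType).
Context (f : {malg K[S]} -> {malg K[S']}) (g : {malg K[T]} -> {malg K[T']}).
HB.instance Definition _ := GRing.Linear.on (tensmap f g).
Lemma tensmapU s t :
  tensmap f g (vec K (s, t)) = tens (f (vec K s)) (g (vec K t)).
Proof. by rewrite /tensmap linext_vec vec.unlock. Qed.
End Tensmap.

HB.instance Definition _ (R S T : choiceType) :=
  GRing.Linear.on (@tensassoc K R S T).
HB.instance Definition _ (T : choiceType) := GRing.Linear.on (@tensmid K T).
HB.instance Definition _ (T : choiceType) (e : {malg K[T]} -> K) :=
  GRing.Linear.on (tenslunit e).
HB.instance Definition _ (T : choiceType) (e : {malg K[T]} -> K) :=
  GRing.Linear.on (tensrunit e).

Lemma tensassocU (R S T : choiceType) (r : R) (s : S) (t : T) :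
  tensassoc (vec K ((r, s), t)) = vec K (r, (s, t)).
Proof. by rewrite /tensassoc linext_vec vec.unlock. Qed.

Lemma tensmidU (T : choiceType) (a b c d : T) :
  tensmid (vec K ((a, b), (c, d))) = vec K ((a, c), (b, d)).
Proof. by rewrite /tensmid linext_vec vec.unlock. Qed.

Lemma tenslunitU (T : choiceType) (e : {malg K[T]} -> K) (s t : T) :
  tenslunit e (vec K (s, t)) = e (vec K s) *: vec K t.
Proof. by rewrite /tenslunit linext_vec vec.unlock. Qed.

Lemma tensrunitU (T : choiceType) (e : {malg K[T]} -> K) (s t : T) :
  tensrunit e (vec K (s, t)) = e (vec K t) *: vec K s.
Proof. by rewrite /tensrunit linext_vec vec.unlock. Qed.

Section MorphSums.
Context (I : Type) (r : seq I) (P : pred I).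

Lemma tens_sumr (S T : choiceType) (x : {malg K[S]}) (F : I -> {malg K[T]}) :
  tens x (\sum_(i <- r | P i) F i) = \sum_(i <- r | P i) tens x (F i).
Proof. exact: linear_sum. Qed.

Lemma tensmap_sum (S S' T T' : choiceType)
    (f : {malg K[S]} -> {malg K[S']}) (g : {malg K[T]} -> {malg K[T']})
    (F : I -> {malg K[(S * T)%type]}) :
  tensmap f g (\sum_(i <- r | P i) F i) = \sum_(i <- r | P i) tensmap f g (F i).
Proof. exact: linear_sum. Qed.

Lemma tensassoc_sum (R S T : choiceType)
    (F : I -> {malg K[((R * S) * T)%type]}) :
  tensassoc (\sum_(i <- r | P i) F i) = \sum_(i <- r | P i) tensassoc (F i).
Proof. exact: linear_sum. Qed.

Lemma tensmid_sum (T : choiceType)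
    (F : I -> {malg K[((T * T) * (T * T))%type]}) :
  tensmid (\sum_(i <- r | P i) F i) = \sum_(i <- r | P i) tensmid (F i).
Proof. exact: linear_sum. Qed.

Lemma tenslunit_sum (T : choiceType) (e : {malg K[T]} -> K)
    (F : I -> {malg K[(T * T)%type]}) :
  tenslunit e (\sum_(i <- r | P i) F i) = \sum_(i <- r | P i) tenslunit e (F i).
Proof. exact: linear_sum. Qed.

Lemma tensrunit_sum (T : choiceType) (e : {malg K[T]} -> K)
    (F : I -> {malg K[(T * T)%type]}) :
  tensrunit e (\sum_(i <- r | P i) F i) = \sum_(i <- r | P i) tensrunit e (F i).
Proof. exact: linear_sum. Qed.

End MorphSums.

(** Vanishing of coefficients passes directly through sums and scalar multiples, whereas supports
    can shrink by cancellation. *)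
Lemma homogP (T : choiceType) (deg : T -> nat) n (x : {malg K[T]}) :
  homog deg n x <-> (forall t, deg t != n -> x@_t = 0).
Proof.
split=> h t; first by move=> tn; apply: mcoeff_outdom; apply: contra tn => /h->.
by move=> tx; apply/eqP; apply: contraTT tx => /h; rewrite -mcoeff_eq0 => ->.
Qed.

Lemma homogU (T : choiceType) (deg : T -> nat) n t :
  deg t = n -> homog deg n (vec K t).
Proof. by move=> <- u; rewrite vec.unlock msuppU oner_eq0 inE => /eqP->. Qed.

Lemma homog_sum (T : choiceType) (deg : T -> nat) n I (r : seq I) (P : pred I)
    (F : I -> {malg K[T]}) :
  (forall i, P i -> homog deg n (F i)) -> homog deg n (\sum_(i <- r | P i) F i).
Proof.
move=> hF; apply/homogP=> t tn; rewrite raddf_sum big1 // => i /hF /homogP.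
exact.
Qed.

Lemma homog_linext (S T : choiceType) (degS : S -> nat) (degT : T -> nat) n
    (f : S -> {malg K[T]}) x :
  (forall s, degS s = n -> homog degT n (f s)) ->
  homog degS n x -> homog degT n (linext f x).
Proof.
move=> hf hx; rewrite /linext big_seq; apply: homog_sum => s /hx /hf /homogP hs.
by apply/homogP=> t /hs; rewrite mcoeffZ => ->; rewrite mulr0.
Qed.

(** As [g] merges no basis vectors, the coefficient of the image at [g s] is that of the argument at
    [s], so the argument can be read off. *)
Lemma linext_basis_inj (S T : choiceType) (g : S -> T) :
  injective g -> injective (linext (fun s => vec K (g s))).
Proof.
move=> gi.
have fE x s : (linext (fun s => vec K (g s)) x)@_(g s) = x@_s.
  elim/malg_lin_ind: x => [t||c x y hx hy].
  - by rewrite linext_vec vec.unlock !mcoeffU (inj_eq gi).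
  - by rewrite linear0 !mcoeff0.
  by rewrite linearP !mcoeffD !mcoeffZ hx hy.
by move=> x y e; apply/malgP=> s; rewrite -!fE e.
Qed.

End MalgLinear.

(** * Families of subsets up to relabelling *)

Section Families.
Implicit Types X Y Z : finType.

Lemma fam_isoI X Y (h : X -> Y) (F : {set {set X}}) (G : {set {set Y}}) :
  bijective h -> (forall S : {set X}, (h @: S \in G) = (S \in F)) ->
  fam_iso F G.
Proof.
move=> bh hE; exists h => //; have [k hK kK] := bh; apply/setP=> S.
by rewrite (mem_relabel _ _ hK kK) -hE (imset_can _ kK).
Qed.

(** Any injection with image [I] serves as a model of the subtype of [I]; this avoids building maps
    between nested subtypes by hand. *)
Lemma fam_iso_restrI X Y (j : Y -> X) (F : {set {set X}}) (G : {set {set Y}})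
    (I : {set X}) :
  injective j -> j @: setT = I ->
  (forall S : {set Y}, (j @: S \in F) = (S \in G)) ->
  fam_iso G (restr F I).
Proof.
move=> ji jI jE.
have jP y : j y \in I by rewrite -jI imset_f.
pose h y : {x | x \in I} := exist _ (j y) (jP y).
have hi : injective h by move=> y y' /(congr1 val) /ji.
apply: (fam_isoI (h := h)).
  by apply: inj_card_bij => //; rewrite card_sig -jI card_imset // cardsT.
by move=> S; rewrite inE -imset_comp -jE.
Qed.

Lemma fam_iso_restr_restr X (F : {set {set X}}) (I : {set X})
    (S : {set {x | x \in I}}) :
  fam_iso (restr (restr F I) S) (restr F (val @: S)).
Proof.
apply: (fam_iso_restrI (j := fun u => val (val u))).
- by move=> u v /val_inj /val_inj.
- apply/setP=> x; apply/imsetP/imsetP => [[u _ ->]|[u uS ->]].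
    by exists (val u) => //; apply: valP.
  by exists (exist _ u uS).
by move=> T; rewrite !inE -imset_comp.
Qed.

Lemma fam_iso_restrT X (F : {set {set X}}) : fam_iso F (restr F setT).
Proof.
by apply: (fam_iso_restrI (j := id)) => [x y //||S]; rewrite imset_id.
Qed.

Lemma val_imsetC X (I : {set X}) (S : {set {x | x \in I}}) :
  val @: (~: S) = I :\: val @: S.
Proof.
apply/setP=> x; rewrite inE; apply/imsetP/andP => [[u + ->]|[xS xI]].
  by rewrite inE (mem_imset _ _ val_inj) => ?; split=> //; apply: valP.
exists (exist _ x xI) => //; rewrite inE; apply: contra xS => h.
by apply/imsetP; exists (exist _ x xI).
Qed.

Lemma big_subsets (V : nmodType) X (I : {set X}) (f : {set X} -> V) :
  \sum_(S : {set {x | x \in I}}) f (val @: S) =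
  \sum_(A : {set X} | A \subset I) f A.
Proof.
have sub (S : {set {x | x \in I}}) : val @: S \subset I.
  by apply/subsetP=> _ /imsetP[u _ ->]; apply: valP.
rewrite (reindex_onto (fun S : {set {x | x \in I}} => val @: S)
           (fun A => val @^-1: A)); last first.
  move=> A AI; apply/setP=> x; apply/imsetP/idP => [[u + ->]|xA].
    by rewrite inE.
  by exists (exist _ x (subsetP AI x xA)); rewrite // inE.
apply: eq_bigl => S; rewrite sub /=; apply/esym/eqP/setP=> u.
by rewrite inE (mem_imset _ _ val_inj).
Qed.

(** * Subsets of a disjoint union and their two traces *)

Section Sum.
Context (X Y : finType).
Implicit Type S : {set X + Y}.

Lemma inl_inj : injective (@inl X Y). Proof. by move=> x y []. Qed.
Lemma inr_inj : injective (@inr X Y). Proof. by move=> x y []. Qed.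

Lemma sum_set_eqP S S' :
  (S == S') = (inl @^-1: S == inl @^-1: S') && (inr @^-1: S == inr @^-1: S').
Proof.
apply/eqP/andP => [->//|[/eqP/setP el /eqP/setP er]]; apply/setP=> -[x|y].
  by have := el x; rewrite !inE.
by have := er y; rewrite !inE.
Qed.

Lemma preim_inl_imset (A : {set X}) (B : {set Y}) :
  inl @^-1: (inl @: A :|: inr @: B) = A.
Proof.
apply/setP=> x; rewrite !inE (mem_imset _ _ inl_inj).
by case: imsetP => [[]//|]; rewrite orbF.
Qed.

Lemma preim_inr_imset (A : {set X}) (B : {set Y}) :
  inr @^-1: (inl @: A :|: inr @: B) = B.
Proof.
apply/setP=> x; rewrite !inE (mem_imset _ _ inr_inj).
by case: imsetP => [[]//|].
Qed.

Lemma sum_setE S : S = inl @: (inl @^-1: S) :|: inr @: (inr @^-1: S).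
Proof.
by apply/eqP; rewrite sum_set_eqP preim_inl_imset preim_inr_imset !eqxx.
Qed.

(** Stated through traces so that isomorphisms between disjoint unions become Boolean identities. *)
Lemma mem_dunion (F : {set {set X}}) (G : {set {set Y}}) S :
  (S \in dunion F G) = (inl @^-1: S \in F) && (inr @^-1: S == set0)
                    || (inr @^-1: S \in G) && (inl @^-1: S == set0).
Proof.
rewrite inE; congr (_ || _); apply/imsetP/andP.
- case=> A AF ->; rewrite -[inl @: A]setU0 -(imset0 inr).
  by rewrite preim_inl_imset preim_inr_imset.
- case=> SF /eqP S0; exists (inl @^-1: S) => //.
  by rewrite [LHS]sum_setE S0 imset0 setU0.
- case=> A AF ->; rewrite -[inr @: A]set0U -(imset0 inl).
  by rewrite preim_inl_imset preim_inr_imset.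
case=> SF /eqP S0; exists (inr @^-1: S) => //.
by rewrite [LHS]sum_setE S0 imset0 set0U.
Qed.

Lemma setC_sum (A : {set X}) (B : {set Y}) :
  ~: (inl @: A :|: inr @: B) = inl @: (~: A) :|: inr @: (~: B).
Proof.
apply/eqP; rewrite sum_set_eqP !preimsetC.
by rewrite !preim_inl_imset !preim_inr_imset !eqxx.
Qed.

End Sum.

Lemma fam_iso_dunionC X Y (F : {set {set X}}) (G : {set {set Y}}) :
  fam_iso (dunion F G) (dunion G F).
Proof.
pose h X Y (u : X + Y) : Y + X :=
  match u with inl x => inr x | inr y => inl y end.
have hK (Z T : finType) : cancel (h Z T) (h T Z) by case.
apply: (fam_isoI (h := h X Y)); first by exists (h Y X).
move=> S; rewrite (can2_imset_pre _ (hK _ _) (hK _ _)) !mem_dunion [RHS]orbC.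
have -> : inl @^-1: (h Y X @^-1: S) = inr @^-1: S
  by apply/setP=> x; rewrite !inE.
by have -> : inr @^-1: (h Y X @^-1: S) = inl @^-1: S
  by apply/setP=> x; rewrite !inE.
Qed.

Lemma fam_iso_dunionA X Y Z (F : {set {set X}}) (G : {set {set Y}})
    (H : {set {set Z}}) :
  fam_iso (dunion (dunion F G) H) (dunion F (dunion G H)).
Proof.
pose h (u : (X + Y) + Z) : X + (Y + Z) :=
  match u with inl (inl x) => inl x | inl (inr y) => inr (inl y)
             | inr z => inr (inr z) end.
pose k (u : X + (Y + Z)) : (X + Y) + Z :=
  match u with inl x => inl (inl x) | inr (inl y) => inl (inr y)
             | inr (inr z) => inr z end.
have hK : cancel h k by case=> [[]|].
have kK : cancel k h by case=> [|[]].
apply: (fam_isoI (h := h)); first by exists k.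
move=> S; rewrite (can2_imset_pre _ hK kK) !mem_dunion.
(* Emptiness of a trace in a nested sum is split further, so that both sides speak of the same three
   traces. *)
rewrite !(sum_set_eqP _ set0) !preimset0.
have -> : inl @^-1: (k @^-1: S) = inl @^-1: (inl @^-1: S)
  by apply/setP=> x; rewrite !inE.
have -> : inl @^-1: (inr @^-1: (k @^-1: S)) = inr @^-1: (inl @^-1: S)
  by apply/setP=> x; rewrite !inE.
have -> : inr @^-1: (inr @^-1: (k @^-1: S)) = inr @^-1: S
  by apply/setP=> x; rewrite !inE.
by do 6!case: (_ \in _) || case: (_ == _).
Qed.

Lemma fam_iso_dunion0 X (F : {set {set X}}) :
  fam_iso F (dunion (set0 : {set {set 'I_0}}) F).
Proof.
exists inr; last by rewrite /dunion /relabel imset0 set0U.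
apply: inj_card_bij; first exact: inr_inj.
by rewrite card_sum card_ord.
Qed.

(** The inclusion [j] commutes with taking traces, so membership on both sides is tested on the same
    sets. *)
Lemma fam_iso_restr_dunion X Y (F : {set {set X}}) (G : {set {set Y}})
    (I : {set X}) (J : {set Y}) :
  fam_iso (dunion (restr F I) (restr G J))
    (restr (dunion F G) (inl @: I :|: inr @: J)).
Proof.
pose j (u : {x | x \in I} + {y | y \in J}) : X + Y :=
  match u with inl x => inl (val x) | inr y => inr (val y) end.
have jl S : inl @^-1: (j @: S) = val @: (inl @^-1: S).
  apply/setP=> x; rewrite inE; apply/imsetP/imsetP => [[[u|//] uS [->]]|].
    by exists u; rewrite ?inE.
  by case=> u uS ->; exists (inl u); rewrite inE // in uS *.
have jr S : inr @^-1: (j @: S) = val @: (inr @^-1: S).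
  apply/setP=> x; rewrite inE; apply/imsetP/imsetP => [[[//|u] uS [->]]|].
    by exists u; rewrite ?inE.
  by case=> u uS ->; exists (inr u); rewrite inE // in uS *.
have vT (Z : finType) (A : {set Z}) : val @: [set: {x | x \in A}] = A.
  apply/setP=> x; apply/imsetP/idP => [[u _ ->]|xA]; first exact: valP.
  by exists (exist _ x xA).
apply: (fam_iso_restrI (j := j)).
- by move=> [u|u] [v|v] //= [/val_inj->].
- by rewrite [LHS]sum_setE jl jr !preimsetT !vT.
by move=> S; rewrite !mem_dunion jl jr !inE !imset_eq0.
Qed.

End Families.

(** * The Hopf algebra of a class of families *)

Section SubClass.
Context (C : setClass).
Implicit Types X Y : finType.

Definition sub_class X (F : member C X) (I : {set X}) : iso_class C :=
  class_of (restr_member F I).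

Lemma sub_class_restr X (F : member C X) (I : {set X})
    (S : {set {x | x \in I}}) :
  sub_class (restr_member F I) S = sub_class F (val @: S).
Proof. exact/class_eqP/fam_iso_restr_restr. Qed.

Lemma sub_classT X (F : member C X) : sub_class F setT = class_of F.
Proof. exact/class_eqP/fam_iso_sym/fam_iso_restrT. Qed.

Lemma sub_class_dunion X Y (F : member C X) (G : member C Y)
    (I : {set X}) (J : {set Y}) :
  sub_class (dunion_member F G) (inl @: I :|: inr @: J) =
  class_mul (sub_class F I) (sub_class G J).
Proof.
by rewrite class_mulE; apply/class_eqP/fam_iso_sym/fam_iso_restr_dunion.
Qed.

Lemma class_mulC : commutative (@class_mul C).
Proof. by move=> a b; apply/class_eqP/fam_iso_dunionC. Qed.

Lemma class_mulA : associative (@class_mul C).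
Proof.
move=> a b c; rewrite -[a]class_reprK -[b]class_reprK -[c]class_reprK.
rewrite !class_mulE.
exact/class_eqP/fam_iso_sym/fam_iso_dunionA.
Qed.

Lemma class_mul0 : left_id (class_of (empty_member C)) (@class_mul C).
Proof.
move=> a; rewrite -[a]class_reprK class_mulE.
exact/class_eqP/fam_iso_sym/fam_iso_dunion0.
Qed.

Lemma class_rank_mul (a b : iso_class C) :
  class_rank (class_mul a b) = (class_rank a + class_rank b)%N.
Proof. by rewrite class_rankE card_sum !card_ord. Qed.

Lemma sub_class_rank X (F : member C X) (I : {set X}) :
  class_rank (sub_class F I) = #|I|.
Proof. by rewrite class_rankE card_sig. Qed.

(** This drop in rank makes the recursion for the antipode terminate. *)
Lemma sub_class_rank_lt n (F : member C 'I_n) (I : {set 'I_n}) :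
  I != setT -> (class_rank (sub_class F I) < n)%N.
Proof.
move=> IT; rewrite sub_class_rank -[X in (_ < X)%N]card_ord -cardsT.
by rewrite proper_card // properT.
Qed.

End SubClass.

(** * Bialgebra axioms, grading and antipode *)

Section ClassHopf.
Context (C : setClass) (K : fieldType).
Implicit Types X Y : finType.
Local Notation B := (iso_class C).
Local Notation e0 := (class_of (empty_member C)).
(* The structure maps are known here only by their values on basis vectors:
   conversion would otherwise unfold their definitions endlessly. *)
Context (mu : {linear {malg K[(B * B)%type]} -> {malg K[B]}})
        (delta : {linear {malg K[B]} -> {malg K[(B * B)%type]}})
        (eps : {linear {malg K[B]} -> K^o}).
Context (muU : forall a b, mu (vec K (a, b)) = vec K (class_mul a b)).
Context (deltaU : forall X (F : member C X), delta (vec K (class_of F)) =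
  \sum_(I : {set X}) vec K (sub_class F I, sub_class F (~: I))).
Context (epsU : forall a, eps (vec K a) = (class_rank a == 0%N)%:R).

Lemma class_hopf_mulA x :
  mu (tensmap mu id x) = mu (tensmap id mu (tensassoc x)).
Proof.
move: x; apply: (malg_lin_ext (f := mu \o tensmap mu id)
  (g := mu \o (tensmap id mu \o @tensassoc K _ _ _))).
case=> [[a b] c]; rewrite /= tensmapU muU tensU muU.
by rewrite tensassocU tensmapU muU tensU muU class_mulA.
Qed.

Lemma class_hopf_mulC x y : mu (tens x y) = mu (tens y x).
Proof.
move: x; apply: (malg_lin_ext (f := mu \o rtens y) (g := mu \o tens y)) => s.
rewrite /= /rtens; move: y.
apply: (malg_lin_ext (f := mu \o tens (vec K s))
  (g := mu \o rtens (vec K s))) => t.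
by rewrite /= /rtens !tensU !muU class_mulC.
Qed.

Lemma class_hopf_mul1 x : mu (tens (vec K e0) x) = x.
Proof.
move: x; apply: (malg_lin_ext (f := mu \o tens _) (g := idfun)) => t.
by rewrite /= tensU muU class_mul0.
Qed.

(** Both sides sum over the ordered decompositions of the ground set into three blocks. The left
    cuts off the last block first, the right cuts off the first. *)
Lemma class_hopf_coassoc x :
  tensassoc (tensmap delta id (delta x)) = tensmap id delta (delta x).
Proof.
move: x; apply: (malg_lin_ext
  (f := @tensassoc K _ _ _ \o (tensmap delta id \o delta))
  (g := tensmap id delta \o delta)) => a /=.
rewrite -[a]class_reprK; set F := class_repr a; set X := 'I_(class_rank a).
pose t A B D := (vec K (sub_class F A, (sub_class F B, sub_class F D))).
rewrite !deltaU !tensmap_sum tensassoc_sum.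
transitivity (\sum_(I : {set X}) \sum_(A : {set X} | A \subset I)
  t A (I :\: A) (~: I)).
  apply: eq_bigr => I _; rewrite tensmapU deltaU tens_suml tensassoc_sum.
  rewrite -(big_subsets _ (fun A => t A (I :\: A) (~: I))).
  apply: eq_bigr => S _.
  by rewrite tensU tensassocU /= !sub_class_restr val_imsetC.
transitivity (\sum_(A : {set X}) \sum_(B : {set X} | B \subset ~: A)
  t A B (~: A :\: B)); last first.
  apply: eq_bigr => A _; rewrite tensmapU deltaU tens_sumr.
  rewrite -(big_subsets _ (fun B => t A B (~: A :\: B))).
  apply: eq_bigr => S _.
  by rewrite tensU !sub_class_restr val_imsetC.
rewrite (exchange_big_dep xpredT) //=; apply: eq_bigr => A _.
(* With the first block [A] fixed, the sets [I] containing [A] correspond to the middle blocks [B]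
   disjoint from [A]. *)
rewrite (reindex_onto (fun B => A :|: B) (fun I => I :\: A)); last first.
  move=> I AI; apply/setP=> x; rewrite !inE.
  by case: (boolP (x \in A)) => //= /(subsetP AI) ->.
apply: eq_big => [B|B /andP[_ /eqP ->]]; last by rewrite setCU setDE.
rewrite subsetUl /= setDUl setDv set0U; apply/eqP/idP => [<-|].
  by rewrite setDE subsetIr.
by rewrite subsets_disjoint setCK => /setDidPl.
Qed.

Lemma class_hopf_epsl x : tenslunit eps (delta x) = x.
Proof.
move: x; apply: (malg_lin_ext (f := tenslunit eps \o delta)
  (g := idfun)) => a /=.
rewrite -[a in LHS]class_reprK deltaU tenslunit_sum (bigD1 set0) //= big1.
  rewrite addr0 tenslunitU epsU sub_class_rank cards0 eqxx.
  by rewrite scale1r /= setC0 sub_classT class_reprK.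
move=> I I0; rewrite tenslunitU epsU sub_class_rank cards_eq0.
by rewrite (negPf I0) scale0r.
Qed.

Lemma class_hopf_epsr x : tensrunit eps (delta x) = x.
Proof.
move: x; apply: (malg_lin_ext (f := tensrunit eps \o delta)
  (g := idfun)) => a /=.
rewrite -[a in LHS]class_reprK deltaU tensrunit_sum (bigD1 setT) //= big1.
  rewrite addr0 tensrunitU epsU sub_class_rank setCT cards0 eqxx.
  by rewrite scale1r /= sub_classT class_reprK.
move=> I IT; rewrite tensrunitU epsU sub_class_rank cards_eq0.
by rewrite -(inj_eq (@setC_inj _)) setCK setC0 (negPf IT) scale0r.
Qed.

Lemma class_hopf_delta_mul x :
  delta (mu x) = tensmap mu mu (tensmid (tensmap delta delta x)).
Proof.
move: x; apply: (malg_lin_ext (f := delta \o mu)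
  (g := tensmap mu mu \o (@tensmid K _ \o tensmap delta delta))) => -[a b] /=.
rewrite muU tensmapU -[a]class_reprK -[b]class_reprK class_mulE.
rewrite !deltaU tens_suml tensmid_sum tensmap_sum.
under [RHS]eq_bigr do rewrite tens_sumr tensmid_sum tensmap_sum.
rewrite [RHS]pair_big /=.
(* A subset of the disjoint union is the same as a pair of subsets, one on each side. *)
rewrite (reindex (fun IJ : {set 'I_(class_rank a)} * {set 'I_(class_rank b)} =>
  inl @: IJ.1 :|: inr @: IJ.2)) /=; last first.
  exists (fun S : {set 'I_(class_rank a) + 'I_(class_rank b)} =>
    (inl @^-1: S, inr @^-1: S)) => [[I J] _|S _] /=.
    by rewrite preim_inl_imset preim_inr_imset.
  by rewrite -sum_setE.
apply: eq_bigr => -[I J] _ /=.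
rewrite tensU tensmidU tensmapU /= !muU tensU.
by rewrite setC_sum !sub_class_dunion.
Qed.

Lemma class_hopf_mul_homog n x :
  homog (fun p : B * B => class_rank p.1 + class_rank p.2)%N n x ->
  homog (@class_rank C) n (mu x).
Proof.
(* The abstract [mu] is put in the form that [homog_linext] accepts. *)
have muE : mu =1 linext (fun p : B * B => vec K (class_mul p.1 p.2)).
  by apply: malg_lin_ext => -[a b]; rewrite /= linext_vec muU.
rewrite muE; apply: homog_linext => -[a b] /= abn.
by apply: homogU; rewrite class_rank_mul.
Qed.

Lemma class_hopf_delta_homog n x : homog (@class_rank C) n x ->
  homog (fun p : B * B => class_rank p.1 + class_rank p.2)%N n (delta x).
Proof.
have deltaE : delta =1 linext (fun a : B => delta (vec K a)).
  by apply: malg_lin_ext => a; rewrite /= linext_vec.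
rewrite deltaE; apply: homog_linext => a an.
rewrite -[a]class_reprK deltaU; apply: homog_sum => I _; apply: homogU.
by rewrite /= !sub_class_rank cardsC card_ord.
Qed.

Lemma class_hopf_eps_homog n x : homog (@class_rank C) n.+1 x -> eps x = 0.
Proof.
have epsE : eps =1 linext (fun a : B => eps (vec K a)).
  by apply: malg_lin_ext => a; rewrite /= linext_vec.
move=> hx; rewrite epsE /linext big_seq big1 // => a /hx an.
by rewrite epsU an scaler0.
Qed.

Context (mem_set0 : forall X F, sc_mem C F -> (set0 : {set X}) \notin F).

(** The only subset of an empty ground set is [set0], which [mem_set0] excludes; so the empty family
    is the only object of rank 0. *)
Lemma class_rank0 (a : B) : class_rank a = 0%N -> a = e0.
Proof.
move=> a0; rewrite -[LHS]class_reprK; apply/class_eqP; move: (class_repr a).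
rewrite a0 => F; suff -> : val F = set0 by apply: fam_iso_refl.
apply/setP=> S; rewrite inE; apply: contraNF (mem_set0 (valP F)).
by have -> // : S = set0 by apply/setP=> -[].
Qed.

Lemma class_hopf_connected0 x :
  homog (@class_rank C) 0 x -> exists c : K, x = c *: vec K e0.
Proof.
move=> hx; exists x@_e0; apply/malgP=> a.
rewrite mcoeffZ vec.unlock mcoeffU mulr_natr.
have [->|ae] := eqVneq e0 a; first by [].
apply: mcoeff_outdom; apply: contra ae => /hx a0.
by apply/eqP/esym/class_rank0.
Qed.

Lemma sub_class0 X (F : member C X) : sub_class F set0 = e0.
Proof. by apply: class_rank0; rewrite sub_class_rank cards0. Qed.

Lemma class_hopf_delta1 : delta (vec K e0) = tens (vec K e0) (vec K e0).
Proof.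
rewrite deltaU (big_pred1 set0) => [|I]; last by apply/esym/eqP/setP=> -[].
rewrite tensU sub_class0; congr (vec K (_, _)).
by apply: class_rank0; rewrite sub_class_rank; apply: eq_card0 => -[].
Qed.

(* The equation [S * id = 1 eps] solved for its term [I = setT]; the first
   argument is fuel, and exceeding the rank suffices. *)
Fixpoint antipode_rec (n : nat) (a : B) : {malg K[B]} :=
  if n is n'.+1 then
    eps (vec K a) *: vec K e0 -
    \sum_(I : {set 'I_(class_rank a)} | I != setT)
      mu (tens (antipode_rec n' (sub_class (class_repr a) I))
               (vec K (sub_class (class_repr a) (~: I))))
  else 0.

(** Recursive calls concern proper subsets, of smaller rank, so both fuels still exceed the rank
    after losing one unit. *)
Lemma antipode_rec_stable m n a :
  (class_rank a < m)%N -> (class_rank a < n)%N ->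
  antipode_rec m a = antipode_rec n a.
Proof.
elim: m n a => [//|m IHm] [//|n] a.
rewrite !ltnS => am an.
rewrite /antipode_rec -/antipode_rec.
apply: (congr1 (fun z => _ - z)); apply: eq_bigr => I IT.
have Ia := sub_class_rank_lt (class_repr a) IT.
by rewrite (IHm n) ?(leq_trans Ia).
Qed.

Definition antipode : {malg K[B]} -> {malg K[B]} :=
  linext (fun a => antipode_rec (class_rank a).+1 a).
HB.instance Definition _ := GRing.Linear.on antipode.

Lemma antipode_vec (n : nat) a : (class_rank a < n)%N ->
  antipode (vec K a) = antipode_rec n a.
Proof.
by move=> an; rewrite /antipode linext_vec; apply: antipode_rec_stable.
Qed.

(** The convolution unit, named so that it carries a linear structure and [malg_lin_ext] applies to
    the antipode equations. *)
Definition unit_counit (x : {malg K[B]}) : {malg K[B]} :=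
  (eps x : K) *: vec K e0.

Fact unit_counit_linear : linear unit_counit.
Proof.
by move=> c x y; rewrite /unit_counit (linearP eps) scalerDl scalerA.
Qed.

HB.instance Definition _ :=
  GRing.isLinear.Build K {malg K[B]} {malg K[B]} *:%R unit_counit
    unit_counit_linear.

(** The term [I = setT] has empty complement and contributes the antipode of [a] itself, which the
    recursion defines as the right side minus the other terms. *)
Lemma antipode_l x : mu (tensmap antipode id (delta x)) = unit_counit x.
Proof.
move: x; apply: (malg_lin_ext (f := mu \o (tensmap antipode id \o delta))
  (g := unit_counit)) => a /=.
rewrite -[a in LHS]class_reprK deltaU tensmap_sum (linear_sum mu).
rewrite (bigD1 setT) //=.
rewrite tensmapU sub_classT setCT sub_class0 class_reprK class_hopf_mulC.
rewrite class_hopf_mul1 (antipode_vec (ltnSn _)) /=.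
(* Subtracting and adding back the terms with [I != setT] reproduces the recursive value, leaving
   two sums to compare. *)
rewrite -[RHS](subrK (\sum_(I : {set 'I_(class_rank a)} | I != setT)
  mu (tens (antipode_rec (class_rank a) (sub_class (class_repr a) I))
           (vec K (sub_class (class_repr a) (~: I)))))).
congr (_ + _); apply: eq_bigr => I IT.
by rewrite tensmapU (antipode_vec (sub_class_rank_lt _ IT)).
Qed.

(** Cocommutativity: complementation permutes the subsets of the ground set. *)
Lemma deltaC a : delta (vec K a) =
  \sum_(I : {set 'I_(class_rank a)})
    vec K (sub_class (class_repr a) (~: I), sub_class (class_repr a) I).
Proof.
rewrite -{1}[a]class_reprK deltaU (reindex_inj (@setC_inj _)) /=.
by apply: eq_bigr => I _; rewrite setCK.
Qed.

(** Exchanging the factors of [delta] by [deltaC], then those of [mu] by commutativity, gives the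
    left equation. *)
Lemma antipode_r x : mu (tensmap id antipode (delta x)) = unit_counit x.
Proof.
rewrite -antipode_l; move: x.
apply: (malg_lin_ext (f := mu \o (tensmap id antipode \o delta))
  (g := mu \o (tensmap antipode id \o delta))) => a /=.
have dE : delta (vec K a) = \sum_(I : {set 'I_(class_rank a)})
    vec K (sub_class (class_repr a) I, sub_class (class_repr a) (~: I)).
  by rewrite -{1}[a]class_reprK deltaU.
rewrite [in LHS]deltaC dE.
rewrite !tensmap_sum [LHS](linear_sum mu) [RHS](linear_sum mu).
by apply: eq_bigr => I _; rewrite !tensmapU; apply: class_hopf_mulC.
Qed.

End ClassHopf.

(** * Multiplicative functionals, used for both the counit and the character *)

Section Character.
Context (C : setClass) (K : fieldType).
Local Notation B := (iso_class C).
Context (mu : {linear {malg K[(B * B)%type]} -> {malg K[B]}})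
        (f : {linear {malg K[B]} -> K^o}).
Context (muU : forall a b, mu (vec K (a, b)) = vec K (class_mul a b)).

Lemma character_mul :
  (forall a b, f (vec K (class_mul a b)) = f (vec K a) * f (vec K b)) ->
  forall x y, f (mu (tens x y)) = f x * f y.
Proof.
(* With [f y] in front, the right side is a scalar multiple of [f], visibly linear in [x]. *)
move=> fM x y; rewrite mulrC; move: x.
apply: (malg_lin_ext (f := f \o (mu \o rtens y)) (g := f y \*: f)) => a.
rewrite /= /rtens -[RHS]/(f y * f (vec K a)) mulrC; move: y.
apply: (malg_lin_ext (f := f \o (mu \o tens (vec K a)))
  (g := f (vec K a) \*: f)) => b /=.
by rewrite tensU muU fM.
Qed.

End Character.

(** * The combinatorial Hopf algebra of a class *)

Section ClassHopfIsCha.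
Context (C : setClass) (K : fieldType).
Local Notation H := (class_hopf C K).
Local Notation B := (iso_class C).

Lemma class_hopf_mulU (a b : B) :
  cha_mul H (vec K (a, b)) = vec K (class_mul a b).
Proof. by rewrite /= linext_vec vec.unlock. Qed.

Lemma class_hopf_deltaU (X : finType) (F : member C X) :
  cha_delta H (vec K (class_of F)) =
  \sum_(I : {set X}) vec K (sub_class F I, sub_class F (~: I)).
Proof. by rewrite /= linext_vec member_delta_class vec.unlock. Qed.

Lemma class_hopf_epsU (a : B) : cha_eps H (vec K a) = (class_rank a == 0%N)%:R.
Proof. by rewrite /= linext_vec. Qed.

Lemma class_hopf_zetaU (a : B) : cha_zeta H (vec K a) = (class_null a)%:R.
Proof. by rewrite /= linext_vec. Qed.

Lemma class_hopf_oneE : cha_one H = vec K (class_of (empty_member C)).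
Proof. by rewrite vec.unlock. Qed.

Context (mem_set0 : forall (X : finType) F,
  sc_mem C F -> (set0 : {set X}) \notin F).
Context (null0 : sc_null C (set0 : {set {set 'I_0}})).
Context (null_dunion : forall (X Y : finType)
    (F : {set {set X}}) (G : {set {set Y}}),
  sc_null C (dunion F G) = sc_null C F && sc_null C G).

Lemma class_hopf_is_cha : is_cha H.
Proof.
split.
- split; rewrite ?class_hopf_oneE.
  + exact: class_hopf_mulA class_hopf_mulU.
  + exact: class_hopf_mul1 class_hopf_mulU.
  + move=> x; rewrite (class_hopf_mulC class_hopf_mulU).
    exact: class_hopf_mul1 class_hopf_mulU _.
  + exact: class_hopf_coassoc class_hopf_deltaU.
  + exact: class_hopf_epsl class_hopf_deltaU class_hopf_epsU.
  + exact: class_hopf_epsr class_hopf_deltaU class_hopf_epsU.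
  + exact: class_hopf_delta_mul class_hopf_mulU class_hopf_deltaU.
  + exact: class_hopf_delta1 class_hopf_deltaU mem_set0.
  + apply: (character_mul class_hopf_mulU) => a b.
    rewrite !class_hopf_epsU class_rank_mul addn_eq0.
    by rewrite -natrM mulnb.
  by rewrite class_hopf_epsU class_rankE card_ord eqxx.
- exists (antipode (cha_mul H) (cha_eps H)) => x.
  rewrite class_hopf_oneE; split.
    exact: (antipode_l (cha_eps H) class_hopf_mulU class_hopf_deltaU mem_set0).
  exact: (antipode_r (cha_eps H) class_hopf_mulU class_hopf_deltaU mem_set0).
- split; rewrite ?class_hopf_oneE.
  + exact: (class_hopf_mul_homog class_hopf_mulU).
  + by apply: homogU; rewrite [LHS]class_rankE card_ord.
  + exact: (class_hopf_delta_homog class_hopf_deltaU).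
  + exact: (class_hopf_eps_homog class_hopf_epsU).
  exact: (class_hopf_connected0 mem_set0).
- apply: (character_mul class_hopf_mulU) => a b.
  rewrite !class_hopf_zetaU -[a]class_reprK -[b]class_reprK.
  by rewrite class_mulE !class_nullE /= null_dunion -natrM mulnb.
by rewrite class_hopf_oneE class_hopf_zetaU class_nullE null0.
Qed.

End ClassHopfIsCha.

(** * Graphical building sets *)

Local Open Scope nat_scope.

Section Graphs.
Implicit Types X Y : finType.

Lemma connected_fam_iso X Y (E : {set {set X}}) (E' : {set {set Y}}) :
  fam_iso E E' -> connected E = connected E'.
Proof.
move=> EE'; apply/idP/idP; apply: connected_iso => //; exact: fam_iso_sym.
Qed.

Lemma graphical_restr X (E : {set {set X}}) (I : {set X}) :
  graphical (restr E I) = restr (graphical E) I.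
Proof.
apply/setP=> S; rewrite !inE imset_eq0.
by rewrite (connected_fam_iso (fam_iso_restr_restr _ _)).
Qed.

(** An edge has two elements, so an edge inside a two-element set fills it. *)
Lemma edge_of_restr X (E : {set {set X}}) (S : {set X}) (u v : {x | x \in S}) :
  is_graph E -> #|S| = 2 -> [set u; v] \in restr E S -> S \in E.
Proof.
move=> gE S2; rewrite inE => uvE.
have /eqP uv2 := forall_inP gE _ uvE.
suff <- : val @: [set u; v] = S by [].
apply/eqP; rewrite eqEcard uv2 S2 leqnn andbT.
by apply/subsetP=> _ /imsetP[w _ ->]; apply: valP.
Qed.

Lemma graphical2 X (E : {set {set X}}) (S : {set X}) :
  is_graph E -> #|S| = 2 -> (S \in graphical E) = (S \in E).
Proof.
move=> gE S2; have S0 : S != set0 by rewrite -card_gt0 S2.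
rewrite inE S0 /=; apply/idP/idP => [cS|SE].
  have /cards2P[a [b [ab Sab]]] : #|S| == 2 by rewrite S2.
  have [aS bS] : a \in S /\ b \in S by rewrite Sab !inE !eqxx orbT.
  have := forallP (forallP cS (exist _ a aS)) (exist _ b bS).
  (* A nonempty path from [a] to [b] starts with an edge inside [S], which is [S]; an empty one
     would force [a = b]. *)
  case/connectP=> -[|w p] /=; last first.
    by case/andP=> /(edge_of_restr gE S2) ->.
  by move=> _ /(congr1 val) /= ba; rewrite ba eqxx in ab.
apply/forallP=> u; apply/forallP=> v; have [->//|uv] := eqVneq u v.
apply: connect1; rewrite /adj /= inE.
suff -> : val @: [set u; v] = S by [].
apply/eqP; rewrite eqEcard S2 card_imset ?cards2 ?uv ?andbT;
  last exact: val_inj.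
by apply/subsetP=> _ /imsetP[w _ ->]; apply: valP.
Qed.

(** An edge would be a two-element member. Conversely, without edges every path is empty, so a
    connected set has at most one point. *)
Lemma discrete_graphical X (E : {set {set X}}) :
  is_graph E -> discrete (graphical E) = edgeless E.
Proof.
move=> gE; apply/forall_inP/eqP => [dE|->{E gE} S].
  apply/setP=> S; rewrite inE; apply/negP=> SE.
  have /eqP S2 := forall_inP gE _ SE.
  by have := dE S; rewrite graphical2 // S2 => /(_ SE).
rewrite inE => /andP[S0 cS]; rewrite eqn_leq card_gt0 S0 andbT.
apply/card_le1_eqP=> x y xS yS.
have := forallP (forallP cS (exist _ x xS)) (exist _ y yS).
case/connectP=> -[|w p] /=; first by move=> _ /(congr1 val).
by rewrite /adj /= !inE.
Qed.

(** The same bijection works: it preserves cardinality, and the two-element members are the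
    edges. *)
Lemma fam_iso_graphical X Y (E : {set {set X}}) (E' : {set {set Y}}) :
  is_graph E -> is_graph E' -> fam_iso (graphical E) (graphical E') ->
  fam_iso E E'.
Proof.
move=> gE gE' [f bf fE]; apply: (fam_isoI bf) => S.
have fS : #|f @: S| = #|S| by apply: card_imset; apply: bij_inj.
have fSE : (f @: S \in graphical E') = (S \in graphical E).
  by rewrite -fE; apply: mem_imset; apply: imset_inj; apply: bij_inj.
have [S2|S2] := eqVneq #|S| 2.
  by rewrite -(graphical2 gE' (S := f @: S)) ?fS // fSE graphical2.
apply/idP/idP => [/(forall_inP gE')|/(forall_inP gE)].
  by rewrite fS (negPf S2).
by rewrite (negPf S2).
Qed.

(** No edge joins the two sides, so one of them must be empty. By the definition of [connected], a
    graph without vertices is connected. *)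
Lemma connected_dunion X Y (E : {set {set X}}) (E' : {set {set Y}}) :
  connected (dunion E E') =
  (#|X| == 0) && connected E' || (#|Y| == 0) && connected E.
Proof.
wlog suff W : X Y E E' / #|X| = 0 -> connected (dunion E E') = connected E'.
  have [X0|/eqP] := eqVneq #|X| 0.
    rewrite W //=; have [Y0|//] := eqVneq #|Y| 0; last by rewrite orbF.
    have cE (Z : finType) (F : {set {set Z}}) : #|Z| = 0 -> connected F.
      by move=> Z0; apply/forallP=> z; have := card0_eq Z0 z; rewrite inE.
    by rewrite !cE.
  have [Y0 _|] := eqVneq #|Y| 0.
    by rewrite (connected_fam_iso (fam_iso_dunionC _ _)) W.
  rewrite -!lt0n => /card_gt0P[y _] /eqP; rewrite -lt0n => /card_gt0P[x _] /=.
  apply/negP=> cE; have := forallP (forallP cE (inl x)) (inr y).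
  case/connectP=> p.
  (* A path starting on the left stays there, since an edge crossing over would have both traces
     nonempty. *)
  have : forall x',
      path (adj (dunion E E')) (inl x') p -> last (inl x') p <> inr y.
    elim: p => [|[x1|y1] p IHp] x' //= /andP[]; first by move=> _; apply: IHp.
    rewrite /adj /= mem_dunion => /orP[] /andP[_ /eqP/setP].
      by move/(_ y1); rewrite !inE eqxx orbT.
    by move/(_ x'); rewrite !inE eqxx.
  by move=> h /h /[swap] <-.
move=> X0; apply/idP/idP => cE; apply/forallP=> y; apply/forallP=> y'.
(* The value [y] is a default for the left side, which is empty. *)
- pose h (u : X + Y) := if u is inr z then z else y.
  suff : connect (adj E') (h (inr y)) (h (inr y')) by [].
  apply: (connect_homo (e := adj (dunion E E')) (h := h)).
    move=> [x|z]; first by have := card0_eq X0 x; rewrite inE.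
    move=> [x|z']; first by have := card0_eq X0 x; rewrite inE.
    rewrite /adj /= mem_dunion => /orP[/andP[_ /eqP/setP/(_ z)]|].
      by rewrite !inE eqxx.
    case/andP=> + _.
    suff -> : inr @^-1: ([set inr z; inr z'] : {set X + Y}) = [set z; z'] by [].
    by apply/setP=> w; rewrite !inE.
  by move/forallP: cE => /(_ (inr y)) /forallP.
case: y => [x|y]; first by have := card0_eq X0 x; rewrite inE.
case: y' => [x|y']; first by have := card0_eq X0 x; rewrite inE.
apply: (connect_homo (e := adj E')); last first.
  by move/forallP: cE => /(_ y) /forallP.
move=> z z' zz'; rewrite /adj /= inE; apply/orP; right.
by apply/imsetP; exists [set z; z']; rewrite // imsetU1 imset_set1.
Qed.

Lemma graphical_dunion X Y (E : {set {set X}}) (E' : {set {set Y}}) :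
  graphical (dunion E E') = dunion (graphical E) (graphical E').
Proof.
apply/setP=> S; rewrite mem_dunion !inE (sum_set_eqP _ set0) !preimset0.
set A := inl @^-1: S; set A' := inr @^-1: S.
have -> : connected (restr (dunion E E') S) =
    connected (dunion (restr E A) (restr E' A')).
  rewrite (sum_setE S); apply/esym/connected_fam_iso.
  exact: fam_iso_restr_dunion.
(* Only the emptiness of the two traces remains to be examined; the case of both empty is excluded
   on each side by the nonemptiness conditions. *)
rewrite connected_dunion !card_sig !cards_eq0.
by case: (A == set0); case: (A' == set0); rewrite ?orbF ?andbF ?andbT.
Qed.

Lemma edgeless_dunion X Y (E : {set {set X}}) (E' : {set {set Y}}) :
  edgeless (dunion E E') = edgeless E && edgeless E'.
Proof. by rewrite /edgeless setU_eq0 !imset_eq0. Qed.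

Lemma discrete_dunion X Y (F : {set {set X}}) (G : {set {set Y}}) :
  discrete (dunion F G) = discrete F && discrete G.
Proof.
apply/forall_inP/andP => [d|[/forall_inP dF /forall_inP dG] S].
  split; apply/forall_inP=> S SF.
    rewrite -(card_imset _ (@inl_inj X Y)); apply: d.
    by rewrite inE imset_f.
  rewrite -(card_imset _ (@inr_inj X Y)); apply: d.
  by rewrite inE imset_f ?orbT.
case/setUP=> /imsetP[T TF ->]; rewrite card_imset ?dF ?dG //.
  exact: inl_inj.
exact: inr_inj.
Qed.

End Graphs.

Local Close Scope nat_scope.

Lemma class_of_eq (C : setClass) (X : finType) (F G : member C X) :
  val F = val G -> class_of F = class_of G.
Proof. by move=> e; apply/class_eqP; rewrite e; apply: fam_iso_refl. Qed.

Lemma decompositions_graphical (X : finType) (E : {set {set X}}) (a : seq nat) :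
  is_graph E ->
  decompositions building_sets (graphical E) a = decompositions graphs E a.
Proof.
(* The conditions on sizes, disjointness and covering do not mention the family; only the last one
   is compared. *)
move=> gE; apply/setP=> J; rewrite !inE /=; do 3![apply: (congr1 (andb _))].
apply: eq_forallb => i; rewrite -graphical_restr discrete_graphical //.
exact: is_graph_restr.
Qed.

(** * The map from graphs to building sets *)

Section Beta.
Context (K : fieldType).
Local Notation G := (iso_class graphs).
Local Notation B := (iso_class building_sets).
Context (f : {linear {malg K[G]} -> {malg K[B]}}).
Context (fU : forall (X : finType) (E : graph X),
  f (vec K (class_of E)) = vec K (class_of (graphical_building E))).

Lemma beta_mul (mu1 : {linear {malg K[(G * G)%type]} -> {malg K[G]}})
    (mu2 : {linear {malg K[(B * B)%type]} -> {malg K[B]}}) :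
  (forall a b, mu1 (vec K (a, b)) = vec K (class_mul a b)) ->
  (forall a b, mu2 (vec K (a, b)) = vec K (class_mul a b)) ->
  forall x, f (mu1 x) = mu2 (tensmap f f x).
Proof.
move=> mu1U mu2U.
apply: (malg_lin_ext (f := f \o mu1) (g := mu2 \o tensmap f f)) => -[a b] /=.
rewrite mu1U tensmapU -[a]class_reprK -[b]class_reprK class_mulE !fU tensU mu2U.
rewrite class_mulE; congr (vec K _); apply: class_of_eq.
exact: graphical_dunion.
Qed.

Lemma beta_delta (delta1 : {linear {malg K[G]} -> {malg K[(G * G)%type]}})
    (delta2 : {linear {malg K[B]} -> {malg K[(B * B)%type]}}) :
  (forall (X : finType) (E : graph X), delta1 (vec K (class_of E)) =
     \sum_(I : {set X}) vec K (sub_class E I, sub_class E (~: I))) ->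
  (forall (X : finType) (F : building_set X), delta2 (vec K (class_of F)) =
     \sum_(I : {set X}) vec K (sub_class F I, sub_class F (~: I))) ->
  forall x, delta2 (f x) = tensmap f f (delta1 x).
Proof.
move=> delta1U delta2U.
apply: (malg_lin_ext (f := delta2 \o f) (g := tensmap f f \o delta1)) => a /=.
rewrite -[a]class_reprK delta1U fU delta2U tensmap_sum; apply: eq_bigr => I _.
rewrite tensmapU !fU tensU; congr (vec K (_, _)); apply: class_of_eq;
  exact/esym/graphical_restr.
Qed.

Lemma beta_homog n x :
  homog (@class_rank graphs) n x -> homog (@class_rank building_sets) n (f x).
Proof.
have fE : f =1 linext (fun a => f (vec K a)).
  by apply: malg_lin_ext => a; rewrite /= linext_vec.
rewrite fE; apply: homog_linext => a an; rewrite -[a]class_reprK fU.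
by apply: homogU; rewrite class_rankE card_ord.
Qed.

(** [f] sends basis vectors to basis vectors, and [fam_iso_graphical] makes the map on classes
    injective. *)
Lemma beta_inj : injective f.
Proof.
pose g (a : G) : B := class_of (graphical_building (class_repr a)).
have fE : f =1 linext (fun a => vec K (g a)).
  by apply: malg_lin_ext => a; rewrite /= linext_vec -{1}[a]class_reprK fU.
apply: eq_inj (fsym fE); apply: linext_basis_inj => a b /class_eqP ab.
rewrite -[a]class_reprK -[b]class_reprK; apply/class_eqP.
by apply: fam_iso_graphical ab; apply: valP.
Qed.

End Beta.

Theorem theorem1 (K : fieldType) (charK : [pchar K] =i pred0) :
  [/\ is_cha_morphism (beta K),
      injective (beta K)
    & forall x, Psi_BSet K (beta K x) = Psi_Graph K x].
Proof.
have mulU (C : setClass) a b :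
    cha_mul (class_hopf C K) (vec K (a, b)) = vec K (class_mul a b).
  exact: class_hopf_mulU.
have deltaU (C : setClass) (X : finType) (F : member C X) :
    cha_delta (class_hopf C K) (vec K (class_of F)) =
    \sum_(I : {set X}) vec K (sub_class F I, sub_class F (~: I)).
  exact: class_hopf_deltaU.
have betaU (X : finType) (E : graph X) :
    beta K (vec K (class_of E)) = vec K (class_of (graphical_building E)).
  by rewrite vec.unlock beta_class.
split; first split.
- apply: class_hopf_is_cha => [X E gE||X Y E E'].
  + by apply/negP=> /(forall_inP gE); rewrite cards0.
  + exact: eqxx.
  exact: edgeless_dunion.
- apply: class_hopf_is_cha => [X F /is_buildingP[]//||X Y F F'].
  + by apply/forall_inP=> S; rewrite inE.
  exact: discrete_dunion.
- exact: (beta_mul betaU (mulU _) (mulU _)).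
- rewrite -[LHS]/(beta K << class_of (empty_member graphs) >>).
  rewrite beta_class; congr << _ >>; apply: class_of_eq.
  (* Members of a graphical building set are nonempty, and ['I_0] has no nonempty subset. *)
  apply/setP=> S; rewrite !inE; apply/negbTE; rewrite negb_and negbK.
  by apply/orP; left; apply/eqP/setP=> -[].
- exact: (beta_delta betaU (deltaU _) (deltaU _)).
- apply: (malg_lin_ext (f := cha_eps (BSet K) \o beta K)
    (g := cha_eps (GraphHopf K))) => a.
  rewrite -[a]class_reprK [LHS]/= betaU.
  rewrite (@class_hopf_epsU building_sets) (@class_hopf_epsU graphs).
  by rewrite !class_rankE.
- exact: (beta_homog betaU).
- apply: (malg_lin_ext (f := cha_zeta (BSet K) \o beta K)
    (g := cha_zeta (GraphHopf K))) => a.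
  rewrite -[a]class_reprK [LHS]/= betaU.
  rewrite (@class_hopf_zetaU building_sets) (@class_hopf_zetaU graphs).
  rewrite !class_nullE.
  congr (nat_of_bool _)%:R; apply: discrete_graphical; exact: valP.
- exact: (beta_inj betaU).
(* Both expansions run over the compositions of the same rank, so the coefficients are compared one
   by one. *)
apply: (malg_lin_ext (f := Psi_BSet K \o beta K) (g := Psi_Graph K)) => a.
rewrite -[a]class_reprK [LHS]/= betaU vec.unlock /Psi_BSet /Psi_Graph.
rewrite !Psi_class.
apply: eq_bigr => c _; rewrite [val _]/= decompositions_graphical //.
exact: valP.
Qed.
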